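(* $\mathrm{ROR}(\mathrm{DNF}) \le \overline{\mathrm{AECR}}(\mathrm{DNF}) \le \frac{2}{3}$.
   Context: Bin covering: a list $L=(a_1,\ldots,a_N)$ of item sizes in $[0,1]$ is given; a bin is covered if its total size is at least $1$. $\mathrm{OPT}(L)$ is the maximum number of pairwise disjoint sets of items of $L$ each of total size at least $1$. Dual Next-Fit ($\mathrm{DNF}$) processes the items in the given order, putting every item into a single current bin; as soon as the current bin has total size at least $1$ it is counted as covered and a new empty current bin is started; $\mathrm{DNF}(L)$ is the number of covered bins. A discrete distribution $F$ is given by non-negative rational item sizes $(s_1,\ldots,s_m)$ and positive rational probabilities $(p_1,\ldots,p_m)$ summing to $1$; $I_n(F)$ is a list of $n$ i.i.d. items drawn from $F$. $\mathrm{AECR}(A,F)=\liminf_{n\to\infty}\mathbb{E}[A(I_n(F))]/\mathbb{E}[\mathrm{OPT}(I_n(F))]$ and $\overline{\mathrm{AECR}}(A)$ is the infimum of $\mathrm{AECR}(A,F)$ over all discrete distributions $F$. The asymptotic random-order ratio is $\mathrm{ROR}(A)=\liminf_{\mathrm{OPT}(L)\to\infty}\mathbb{E}_\sigma[A(\sigma(L))]/\mathrm{OPT}(L)$, where $\sigma(L)$ is the list $L$ permuted by a uniformly random permutation $\sigma$ of its $N(L)$ positions, and the liminf is $\lim_{k\to\infty}\inf_{L:\,\mathrm{OPT}(L)\ge k}$. *)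

(* Defs.v *)
From HB Require Import structures.
From mathcomp Require Import all_boot all_order perm all_algebra.
From mathcomp Require Import all_classical all_reals all_analysis.

Set Implicit Arguments.
Unset Strict Implicit.
Unset Printing Implicit Defensive.

Import Order.TTheory GRing.Theory Num.Theory.
Import numFieldNormedType.Exports.

Local Open Scope classical_set_scope.
Local Open Scope ring_scope.

Section BinCovering.
Variable R : realType.

Definition item_list (L : seq R) : bool := all (fun a => 0 <= a <= 1) L.

(** Sets of items are sets of positions, so equal sizes at different positions
    are different items.  A set of total size at least 1 is nonempty, so a
    disjoint family of such sets has no repetition, and counting it as a
    [{set {set _}}] loses nothing. *)
Definition covering (L : seq R) (P : {set {set 'I_(size L)}}) : bool :=
  finset.trivIset P && [forall B in P, 1 <= \sum_(i in B) L`_i].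

Definition OPT (L : seq R) : nat :=
  \max_(P : {set {set 'I_(size L)}} | covering P) #|P|.

Fixpoint DNF_from (content : R) (L : seq R) : nat :=
  if L is a :: L' then
    if 1 <= content + a then (DNF_from 0 L').+1 else DNF_from (content + a) L'
  else 0%N.

Definition DNF (L : seq R) : nat := DNF_from 0 L.

Record discrete_distribution := DiscreteDistribution {
  dd_num : nat;
  dd_size : 'I_dd_num -> rat;
  dd_prob : 'I_dd_num -> rat;
  dd_size_itv : forall i, 0 <= dd_size i <= 1;
  dd_prob_gt0 : forall i, 0 < dd_prob i;
  dd_prob_sum : \sum_i dd_prob i = 1
}.

(** Expectation of [A] on a list of [n] i.i.d. items drawn from [F]: [t] lists
    the indices drawn, and has probability [\prod_i p_(t_i)]. *)
Definition expect_iid (A : seq R -> nat) (F : discrete_distribution) (n : nat)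
    : R :=
  \sum_(t : n.-tuple 'I_(dd_num F))
    (\prod_(i < n) ratr (dd_prob (tnth t i))) *
    (A [seq ratr (dd_size j) | j <- t])%:R.

Definition AECR (A : seq R -> nat) (F : discrete_distribution) : \bar R :=
  limn_einf (fun n => (expect_iid A F n / expect_iid OPT F n)%:E).

(** If every size in the support of [F] is 0 then [E[OPT(I_n(F))] = 0] for all
    [n], and the quotient in [AECR A F] is the undefined 0/0 (which would be 0
    here); such [F] are left out of the infimum.  For every other [F] the
    denominator is positive for all large [n]. *)
Definition has_positive_size (F : discrete_distribution) : Prop :=
  exists i, 0 < dd_size (d := F) i.

Definition AECR_inf (A : seq R -> nat) : \bar R :=
  ereal_inf [set AECR A F | F in has_positive_size].

Definition permuted (L : seq R) (s : 'S_(size L)) : seq R :=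
  [seq L`_(s i) | i <- enum 'I_(size L)].

Definition expect_perm (A : seq R -> nat) (L : seq R) : R :=
  (\sum_(s : 'S_(size L)) (A (permuted s))%:R) / ((size L)`!)%:R.

(** The division by [OPT L] is genuine as soon as [0 < k]. *)
Definition ROR (A : seq R -> nat) : \bar R :=
  limn (fun k : nat => ereal_inf
    [set (expect_perm A L / (OPT L)%:R)%:E |
      L in [set L | item_list L /\ (k <= OPT L)%N]]).

End BinCovering.

(* Main.v *)
(** ROR <= AECR.  I.i.d. items are exchangeable, so E[A(I_n)] is the mean over
    L = I_n of E_sigma[A(sigma(L))].  If r bounds the random-order ratio from
    below on all lists with OPT(L) >= k, then E[A(I_n)] >= r (E[OPT(I_n)] - k),
    and E[OPT(I_n)] tends to infinity with n.

    AECR <= 2/3.  Take the sizes d_1 << d_2 << ... << d_k and their complements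
    1 - d_j, all equally likely.  Matching complements gives
    E[OPT(I_n)] = n/2 - o(n).  If the scales are separated enough, m items leave
    a bin uncovered when they are all small, which has probability 2^-m, or when
    exactly one item is large, 1 - d_j, and the others are small of scale below
    j, which for large k has probability close to m 2^-m * (1/m) = 2^-m.  So a
    bin of DNF receives about 1 + 2 (1/2 + 1/4 + ...) = 3 items and DNF covers
    about n/3 bins. *)
Require Import Defs.
From mathcomp Require Import all_boot all_order perm all_algebra.
From mathcomp Require Import all_classical all_reals all_analysis.
From mathcomp Require Import ring lra.

Set Implicit Arguments.
Unset Strict Implicit.
Unset Printing Implicit Defensive.

Import Order.TTheory GRing.Theory Num.Theory.

Local Open Scope classical_set_scope.
Local Open Scope ring_scope.

(** * Expectation over lists of i.i.d. items *)

Section IidExpectation.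
Variables (R : realType) (T : finType) (p : T -> R).

(** [f] takes lists of any length, so that conditioning on the first item stays within the same
    type. *)
Definition Eiid (n : nat) (f : seq T -> R) : R :=
  \sum_(t : n.-tuple T) (\prod_(i < n) p (tnth t i)) * f t.

Lemma Eiid0 f : Eiid 0 f = f [::].
Proof.
rewrite /Eiid (big_pred1 [tuple]); first by rewrite big_ord0 mul1r.
by move=> t; apply/esym/eqP; exact: tuple0.
Qed.

Lemma EiidS n f : Eiid n.+1 f = \sum_x p x * Eiid n (fun t => f (x :: t)).
Proof.
transitivity (\sum_x \sum_(t : n.-tuple T)
    p x * ((\prod_(i < n) p (tnth t i)) * f (x :: t))); last first.
  by apply: eq_bigr => x _; rewrite mulr_sumr.
rewrite pair_big /= /Eiid.
rewrite (reindex (fun u : T * n.-tuple T => cons_tuple u.1 u.2)) /=; last first.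
  exists (fun t : n.+1.-tuple T => (thead t, behead_tuple t)).
    by move=> [x t] _ /=; rewrite theadE; congr (_, _); apply/val_inj.
  by move=> t _ /=; rewrite [RHS]tuple_eta; apply/val_inj.
apply: eq_bigr => -[x t] _ /=; rewrite big_ord_recl mulrA; congr (p _ * _ * _).
by apply: eq_bigr => i _; rewrite tnthS.
Qed.

Lemma EiidD n f g : Eiid n (fun t => f t + g t) = Eiid n f + Eiid n g.
Proof. by rewrite /Eiid -big_split; apply: eq_bigr => t _; rewrite mulrDr. Qed.

Lemma EiidZ n a f : Eiid n (fun t => a * f t) = a * Eiid n f.
Proof. by rewrite /Eiid mulr_sumr; apply: eq_bigr => t _; rewrite mulrCA. Qed.

Lemma Eiid_sum n (I : finType) (f : I -> seq T -> R) :
  Eiid n (fun t => \sum_i f i t) = \sum_i Eiid n (f i).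
Proof.
by rewrite /Eiid exchange_big; apply: eq_bigr => t _; rewrite mulr_sumr.
Qed.

Lemma eq_Eiid n f g : (forall t, size t = n -> f t = g t) -> Eiid n f = Eiid n g.
Proof. by move=> fg; apply: eq_bigr => t _; rewrite fg ?size_tuple. Qed.

Hypothesis p_ge0 : forall x, 0 <= p x.

Lemma le_Eiid n f g :
  (forall t, size t = n -> f t <= g t) -> Eiid n f <= Eiid n g.
Proof.
move=> fg; apply: ler_sum => t _; apply: ler_wpM2l; last exact/fg/size_tuple.
exact: prodr_ge0.
Qed.

Hypothesis p_sum : \sum_x p x = 1.

Lemma Eiid_cst n a : Eiid n (fun=> a) = a.
Proof.
elim: n => [|n IHn]; first exact: Eiid0.
by rewrite EiidS (eq_bigr _ (fun x _ => congr1 _ IHn)) -mulr_suml p_sum mul1r.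
Qed.

Lemma Eiid_sumn n (g : T -> R) (v : R) : \sum_x p x * g x = v ->
  Eiid n (fun t => \sum_(x <- t) g x) = v *+ n.
Proof.
move=> gv; elim: n => [|n IHn]; first by rewrite Eiid0 big_nil.
rewrite EiidS mulrS -gv.
under eq_bigr => x _.
  rewrite (@eq_Eiid _ _ (fun t => g x + \sum_(y <- t) g y)); last first.
    by move=> t _; rewrite big_cons.
  rewrite EiidD Eiid_cst IHn mulrDr.
  over.
by rewrite big_split /= -mulr_suml p_sum mul1r gv.
Qed.

Lemma Eiid_sqr_sumn n (g : T -> R) (v : R) :
  \sum_x p x * g x = 0 -> \sum_x p x * g x ^+ 2 = v ->
  Eiid n (fun t => (\sum_(x <- t) g x) ^+ 2) = v *+ n.
Proof.
move=> g0 gv.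
(* The shift [z] absorbs the first item in the induction; the cross terms vanish because [g] is
   centred. *)
suff key z : Eiid n (fun t => (z + \sum_(x <- t) g x) ^+ 2) = z ^+ 2 + v *+ n.
  by move: (key 0); rewrite expr0n add0r => <-; apply: eq_Eiid => t _; rewrite add0r.
elim: n z => [|n IHn] z; first by rewrite Eiid0 big_nil !addr0.
rewrite EiidS.
under eq_bigr => x _.
  rewrite (@eq_Eiid _ _ (fun t => (z + g x + \sum_(y <- t) g y) ^+ 2)); last first.
    by move=> t _; rewrite big_cons addrA.
  rewrite IHn (_ : _ * _ =
    p x * (z ^+ 2 + v *+ n) + 2 * z * (p x * g x) + p x * g x ^+ 2); last by ring.
  over.
rewrite !big_split /= -mulr_suml -mulr_sumr p_sum g0 gv mulrS; ring.
Qed.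

End IidExpectation.

(** * Exchangeability of i.i.d. items *)

Section Exchangeability.
Variables (R : realType) (T : finType) (p : T -> R).

Lemma Eiid_perm n (f : seq T -> R) (s : 'S_n) :
  Eiid p n f =
  \sum_(t : n.-tuple T) (\prod_(i < n) p (tnth t i)) *
     f [tuple tnth t (s i) | i < n].
Proof.
rewrite /Eiid (reindex (fun t : n.-tuple T => [tuple tnth t (s i) | i < n])) /=.
  apply: eq_bigr => t _; congr (_ * _).
  rewrite [RHS](reindex_inj (@perm_inj _ s)) /=.
  by apply: eq_bigr => i _; rewrite tnth_mktuple.
exists (fun t : n.-tuple T => [tuple tnth t ((s^-1)%g i) | i < n]) => t _;
  by apply: eq_from_tnth => i; rewrite !tnth_mktuple ?permK ?permKV.
Qed.

Lemma expect_permE (A : seq R -> nat) (n : nat) (L : seq R) : size L = n ->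
  expect_perm A L =
  (\sum_(s : 'S_n) (A [seq L`_(s i) | i <- enum 'I_n])%:R) / n`!%:R.
Proof. by move=> <-. Qed.

(** Permuting the positions preserves the product weight, so the expectation equals each of its [n!]
    permuted forms, hence their mean. *)
Lemma Eiid_expect_perm (A : seq R -> nat) n (g : T -> R) :
  Eiid p n (fun t => (A [seq g x | x <- t])%:R) =
  Eiid p n (fun t => expect_perm A [seq g x | x <- t]).
Proof.
pose f (t : seq T) : R := (A [seq g x | x <- t])%:R.
have fact_neq0 : n`!%:R != 0 :> R by rewrite pnatr_eq0 -lt0n fact_gt0.
apply: (mulIf fact_neq0).
transitivity (\sum_(s : 'S_n) Eiid p n f).
  by rewrite sumr_const card_Sn mulr_natr.
rewrite (eq_bigr _ (fun s _ => Eiid_perm f s)) exchange_big /= mulr_suml.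
apply: eq_bigr => t _; rewrite -mulr_sumr -mulrA; congr (_ * _).
rewrite (@expect_permE _ n) ?size_map ?size_tuple// mulfVK//.
apply: eq_bigr => s _; rewrite /f; congr (A _)%:R.
rewrite -map_comp; apply: eq_map => i /=.
rewrite (nth_map (tnth_default t i)) ?size_tuple//.
by rewrite -tnth_nth.
Qed.

End Exchangeability.

(** * Coverings as labelled lists, and bounds on DNF *)

Section Covering.
Variable R : realType.
Implicit Types L : seq R.

(** Each item carries the label of its bin, and labels from [k] on mark leftovers. Unlike sets of
    positions, this survives insertion and reordering of items. *)
Definition coverable (L : seq R) (k : nat) : Prop :=
  exists2 Z : seq (R * nat), perm_eq [seq z.1 | z <- Z] L &
    forall j, (j < k)%N -> 1 <= \sum_(z <- Z | z.2 == j) z.1.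

Lemma coverable_perm L L' k : perm_eq L L' -> coverable L k -> coverable L' k.
Proof. by move=> LL' [Z ZL Z1]; exists Z => //; apply: perm_trans ZL LL'. Qed.

Lemma coverable_aligned L k : coverable L k ->
  exists2 Z : seq (R * nat), [seq z.1 | z <- Z] = L &
    forall j, (j < k)%N -> 1 <= \sum_(z <- Z | z.2 == j) z.1.
Proof.
move=> [Z ZL Z1]; rewrite perm_sym in ZL.
have [Is Iperm ->] := perm_iotaP 0 ZL.
rewrite size_map in Iperm.
exists [seq nth (0, 0%N) Z i | i <- Is].
  rewrite -map_comp; apply/eq_in_map => i iIs /=.
  rewrite (nth_map (0, 0%N))//.
  by move: iIs; rewrite (perm_mem Iperm) mem_iota.
move=> j /Z1; rewrite (perm_big [seq nth (0, 0%N) Z i | i <- Is])//.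
by rewrite -[X in perm_eq X _](mkseq_nth (0, 0%N)) perm_map// perm_sym.
Qed.

(** After alignment, each label below [k] gives a set of positions. These sets have positive sum, so
    they are nonempty, and being disjoint they are distinct: there are exactly [k] of them. *)
Lemma coverable_OPT L k : coverable L k -> (k <= OPT L)%N.
Proof.
move=> /coverable_aligned[Z ZL Z1].
have sZ : size Z = size L by rewrite -ZL size_map.
pose bin (j : 'I_k) : {set 'I_(size L)} :=
  [set i : 'I_(size L) | (nth (0, 0%N) Z i).2 == j]%SET.
have sum_bin j : 1 <= \sum_(i in bin j) L`_i.
  rewrite (le_trans (Z1 _ (ltn_ord j)))// le_eqVlt; apply/orP; left; apply/eqP.
  rewrite (big_nth (0, 0%N)) sZ big_mkord; apply: eq_big => [i|i _].
    by rewrite inE.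
  by rewrite -(nth_map (0, 0%N) 0 (fun z => z.1)) ?sZ// ZL.
have bin_neq0 j : exists i, i \in bin j.
  apply/set0Pn/eqP => b0; have := sum_bin j.
  by rewrite b0 big_set0 ler10.
have bin_inj : injective bin.
  move=> j1 j2 b12; have [i i1] := bin_neq0 j1.
  have i2 : i \in bin j2 by rewrite -b12.
  move: i1 i2; rewrite !inE => /eqP i1 /eqP i2.
  by apply/val_inj; rewrite -[LHS]i1 -[RHS]i2.
pose P := [set bin j | j in 'I_k]%SET.
have <- : #|P| = k by rewrite card_imset// card_ord.
apply: leq_bigmax_cond; apply/andP; split.
  apply/finset.trivIsetP => _ _ /imsetP[j1 _ ->] /imsetP[j2 _ ->] neq.
  apply/pred0P => i; rewrite /= !inE; apply/negbTE/negP => /andP[/eqP i1 /eqP i2].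
  by case/eqP: neq; congr bin; apply/val_inj; rewrite -[LHS]i1 -[RHS]i2.
by apply/forall_inP => _ /imsetP[j _ ->].
Qed.

Lemma coverable0 L : coverable L 0.
Proof.
by exists [seq (a, 0%N) | a <- L] => //; rewrite -map_comp map_id_in.
Qed.

Lemma coverable_cons2 a b L k :
  1 <= a + b -> coverable L k -> coverable (a :: b :: L) k.+1.
Proof.
move=> ab [Z ZL Z1].
(* Label [k] becomes that of the new bin, so the leftover items labelled [k] or
   more are moved to label [k.+1]. *)
exists [:: (a, k), (b, k) & [seq z <- Z | z.2 < k]%N
   ++ [seq (z.1, k.+1) | z <- Z & ~~ (z.2 < k)%N]] => /=.
  rewrite !perm_cons map_cat -map_comp /= -map_cat.
  by apply: perm_trans ZL; apply: perm_map; rewrite perm_filterC.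
move=> j; rewrite ltnS leq_eqVlt => /predU1P[->|jk].
  rewrite !big_cons /= eqxx addrA big_cat /=.
  rewrite [X in _ + (X + _)]big1_seq ?[X in _ + (_ + X)]big1_seq ?addr0//.
    move=> i /= /andP[/eqP ik /mapP[z _ zi]].
    by move: ik; rewrite zi /= => /eqP; rewrite eqn_leq ltnn.
  by move=> i /= /andP[/eqP ik]; rewrite mem_filter ik ltnn.
rewrite !big_cons /= (gtn_eqF jk) big_cat /= [X in _ + X]big1_seq ?addr0.
  rewrite big_filter_cond.
  rewrite (le_trans (Z1 _ jk))// le_eqVlt; apply/orP; left; apply/eqP.
  by apply: eq_bigl => z; case: eqP => [->|_]; rewrite ?jk ?andbF.
move=> i /= /andP[/eqP ij /mapP[z _ zi]].
by move: ij jk; rewrite zi /= => <-; rewrite ltnNge leqnSn.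
Qed.

Lemma coverable_DNF_from L c : exists2 Z : seq (R * nat),
  [seq z.1 | z <- Z] = L &
  forall j, (j < DNF_from c L)%N ->
    1 <= c *+ (j == 0%N) + \sum_(z <- Z | z.2 == j) z.1.
Proof.
elim: L c => [|a L IHL] c /=; first by exists [::].
case: ifP => [ca1|_].
  (* Label 0 is the current bin, which [a] closes; all later bins move up by one label. *)
  have [Z <- Z1] := IHL 0; exists ((a, 0%N) :: [seq (z.1, z.2.+1) | z <- Z]).
    by rewrite /= -map_comp.
  case=> [_|j]; rewrite big_cons big_map /=.
    by rewrite big_pred0 ?addr0.
  by rewrite ltnS => /Z1; rewrite mul0rn !add0r.
have [Z <- Z1] := IHL (c + a); exists ((a, 0%N) :: Z) => // -[|j] /Z1 /=.
  by rewrite big_cons /= !mulr1n addrA.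
by rewrite big_cons /=.
Qed.

Lemma DNF_le_OPT L : (DNF L <= OPT L)%N.
Proof.
apply: coverable_OPT; have [Z ZL Z1] := coverable_DNF_from L 0.
exists Z => [|j /Z1]; first by rewrite ZL.
by rewrite mul0rn add0r.
Qed.

(** A covered bin was below 1 before its last item, hence holds less than 2; the last open bin holds
    less than 1. *)
Lemma sum_le_DNF_from L c : item_list L -> c < 1 ->
  c + \sum_(a <- L) a <= (DNF_from c L)%:R * 2 + 1.
Proof.
elim: L c => [|a L IHL] c /=.
  by move=> _ c1; rewrite big_nil; lra.
move=> /andP[/andP[a0 a1] L1] c1; rewrite big_cons addrA.
case: ifP => [_|/negbT]; last by rewrite -ltNge; exact: IHL.
by have := IHL 0 L1 ltr01; rewrite -natr1; lra.
Qed.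

(** The two claims are proved together: when only one of the two runs closes its bin, each claim
    falls back on the other. *)
Lemma DNF_from_le L : item_list L ->
  (forall c c', c <= c' -> (DNF_from c L <= DNF_from c' L)%N) /\
  (forall c c', 0 <= c' -> (DNF_from c L <= (DNF_from c' L).+1)%N).
Proof.
elim: L => [|a L IHL]//= /andP[/andP[a0 _] /IHL[le1 le2]]; split => c c' cc'.
  case: ifP => ca; case: ifP => c'a.
  - by [].
  - by move: c'a; rewrite (le_trans ca)// lerD2r.
  - exact: le2.
  - by apply: le1; rewrite lerD2r.
case: ifP => ca; case: ifP => c'a.
- by [].
- by rewrite ltnS le1// addr_ge0.
- by rewrite (leq_trans (le2 _ 0 _)).
- by apply: le2; rewrite addr_ge0.
Qed.

End Covering.

(** * Bounding DNF by the mean number of items per bin *)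

Section Survival.
Variables (R : realType) (T : finType) (p g : T -> R).
Hypothesis p_ge0 : forall x, 0 <= p x.
Hypothesis p_sum : \sum_x p x = 1.
Hypothesis g_itv : forall x, 0 <= g x <= 1.

(* The probability that [m] more items leave a bin of content [c < 1] uncovered. *)
Fixpoint survival (m : nat) (c : R) : R :=
  if m is m'.+1 then
    \sum_x p x * (if c + g x < 1 then survival m' (c + g x) else 0)
  else 1.

(** By the tail-sum formula this is the mean of the minimum of [r] and the number of items needed to
    cover the bin. *)
Definition mean_survival (r : nat) (c : R) : R := \sum_(m < r) survival m c.

Lemma survival_ge0 m c : 0 <= survival m c.
Proof.
elim: m c => [|m IHm] c //=; apply: sumr_ge0 => x _.
by apply: mulr_ge0 => //; case: ifP.
Qed.

Lemma mean_survivalS r c : mean_survival r.+1 c =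
  1 + \sum_x p x * (if c + g x < 1 then mean_survival r (c + g x) else 0).
Proof.
rewrite /mean_survival big_ord_recl; congr (_ + _).
rewrite /= exchange_big /=; apply: eq_bigr => x _.
by rewrite -mulr_sumr; case: ifP => // _; rewrite sumr_const mul0rn.
Qed.

Lemma item_list_map (t : seq T) : item_list [seq g x | x <- t].
Proof. by apply/allP => _ /mapP[x _ ->]. Qed.

(* Counting a bin as covered once it has received [M] items only helps the
   algorithm.  The potential [1 - a * mean_survival r c] is the expected gain of
   a bin with content [c] that is [r] items away from this cutoff, compared with
   a bin that is just opened. *)
Lemma Eiid_DNF_from_le (a : R) (M n : nat) : 0 <= a ->
  1 <= a * mean_survival M 0 ->
  forall r c, (r <= M)%N ->
  Eiid p n (fun t => (DNF_from c [seq g x | x <- t])%:R) <=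
    a * n%:R + a * M%:R + 1 - a * mean_survival r c.
Proof.
move=> a0 aM; elim: n => [|n IHn].
  move=> r c rM; rewrite Eiid0 /= mulr0 add0r.
  (* A survival probability is at most 1, so [mean_survival r c] is at most [r]. *)
  suff : a * mean_survival r c <= a * M%:R by lra.
  apply: ler_wpM2l => //; apply: le_trans (_ : r%:R <= _); last by rewrite ler_nat.
  rewrite -[r in leRHS]card_ord -sum1_card natr_sum; apply: ler_sum => m _.
  elim: {m}(m : nat) c => [|m IHm] c //=.
  rewrite -[leRHS]p_sum; apply: ler_sum => x _; rewrite ler_piMr//.
  by case: ifP.
have IH0 : Eiid p n (fun t => (DNF_from 0 [seq g x | x <- t])%:R) <=
    a * n%:R + a * M%:R by have := IHn M 0 (leqnn _); lra.
have step r c : (r < M)%N ->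
    Eiid p n.+1 (fun t => (DNF_from c [seq g x | x <- t])%:R) <=
    a * n.+1%:R + a * M%:R + 1 - a * mean_survival r.+1 c.
  move=> rM; rewrite EiidS mean_survivalS -natr1.
  set B := a * n%:R + a * M%:R in IH0 *.
  have -> : a * (n%:R + 1) + a * M%:R + 1 - a * (1 + \sum_x p x *
      (if c + g x < 1 then mean_survival r (c + g x) else 0)) =
      \sum_x p x * (B + 1 - a *
        (if c + g x < 1 then mean_survival r (c + g x) else 0)).
    under [RHS]eq_bigr => x _ do rewrite mulrBr mulrCA.
    by rewrite sumrB -mulr_suml -mulr_sumr p_sum /B; ring.
  apply: ler_sum => x _; apply: ler_wpM2l => //.
  rewrite [X in Eiid _ _ X](_ : _ = (fun t =>
    (if 1 <= c + g x then (DNF_from 0 [seq g x | x <- t]).+1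
     else DNF_from (c + g x) [seq g x | x <- t])%:R))//.
  case: ltP => cx.
    by have := IHn r (c + g x) (ltnW rM); rewrite /B.
  rewrite (@eq_Eiid _ _ _ _ _ (fun t =>
    1 + (DNF_from 0 [seq g x | x <- t])%:R)) => [|t _]; last by rewrite -nat1r.
  rewrite EiidD Eiid_cst//; lra.
move=> [|r] c rM; last exact: step.
(* At [r = 0] the cutoff is reached: the bin is counted as covered and replaced by an empty one, to
   which [step] applies. *)
rewrite /mean_survival big_ord0 mulr0 subr0.
case: M => [|M] in aM rM IHn IH0 step *.
  by move: aM; rewrite /mean_survival big_ord0 mulr0 ler10.
apply: (@le_trans _ _ (Eiid p n.+1 (fun t =>
    1 + (DNF_from 0 [seq g x | x <- t])%:R))).
  apply: le_Eiid => // t _; rewrite nat1r ler_nat.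
  by have [_] := DNF_from_le (item_list_map t); exact.
rewrite EiidD Eiid_cst//; have := step M 0 (ltnSn _); lra.
Qed.

End Survival.

Lemma ler_sum_split (R : realType) (k j : nat) (u v : nat -> R) (F : 'I_k -> R) :
  (j <= k)%N -> (forall i : 'I_k, (i < j)%N -> u i <= F i) ->
  (forall i : 'I_k, (j <= i)%N -> v i <= F i) ->
  \sum_(0 <= i < j) u i + \sum_(j <= i < k) v i <= \sum_(i < k) F i.
Proof.
move=> jk uF vF; pose G i := if (i < j)%N then u i else v i.
have -> : \sum_(0 <= i < j) u i + \sum_(j <= i < k) v i = \sum_(0 <= i < k) G i.
  rewrite [RHS](big_cat_nat (n := j))//=; congr (_ + _); apply: eq_big_nat => i.
    by rewrite /G => /andP[_ ->].
  by move=> /andP[ji _]; rewrite /G ltnNge ji.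
rewrite big_mkord; apply: ler_sum => i _; rewrite /G.
by case: ltnP => ij; [exact: uF|exact: vF].
Qed.

(** * Small sizes and their complements, equally likely *)

Section PairedSizes.
Variables (R : realType) (k : nat) (g : 'I_(k + k) -> R).
Hypothesis k_gt0 : (0 < k)%N.
Let p (x : 'I_(k + k)) : R := (k + k)%:R^-1.

Let k0 : 0 < k%:R :> R. Proof. by rewrite ltr0n. Qed.

Lemma paired_prob_sum : \sum_x p x = 1.
Proof.
rewrite /p sumr_const card_ord -[LHS]mulr_natr mulVf// pnatr_eq0.
by rewrite addn_eq0 andbb -lt0n.
Qed.

(** * Survival of a bin under separated scales *)

Section Scales.
Variables (N : nat) (e : nat -> R).
Hypothesis N_gt0 : (0 < N)%N.
Hypothesis e_gt0 : forall j, 0 < e j.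
Hypothesis e_step : forall j, N%:R * e j <= e j.+1.
Hypothesis e_top : N%:R * e k < 1.
Hypothesis g_small : forall i, g (lshift k i) = N%:R * e i.
Hypothesis g_large : forall i, g (rshift k i) = 1 - N%:R * e i.

Lemma e_mono i j : (i <= j)%N -> e i <= e j.
Proof.
suff : {homo e : i j / (i <= j)%N >-> i <= j} by apply.
apply: homo_leq => [//|y x z|m]; first exact: le_trans.
by apply: le_trans (e_step m); rewrite ler_peMl ?ler1n// ltW.
Qed.

Lemma survivalS m c : survival p g m.+1 c = (k + k)%:R^-1 *
  \sum_(i < k)
   ((if c + N%:R * e i < 1 then survival p g m (c + N%:R * e i) else 0) +
    (if c + (1 - N%:R * e i) < 1 then survival p g m (c + (1 - N%:R * e i))
     else 0)).
Proof.
rewrite /= -mulr_sumr big_split_ord /= big_split /=; congr (_ * (_ + _)).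
  by apply: eq_bigr => i _; rewrite g_small.
by apply: eq_bigr => i _; rewrite g_large.
Qed.

Let p_ge0 x : 0 <= p x. Proof. by rewrite invr_ge0. Qed.

Let s_ge0 (b : bool) m c : 0 <= (if b then survival p g m c else 0).
Proof. by case: b => //; apply: survival_ge0. Qed.

(* [e j] bounds the size of every small item of scale below [j], so the
   hypotheses on [c] reserve [e j] for each of the [m] items to come. *)
Lemma survival_large j m c : (j <= k)%N -> c + m.+1%:R * e j <= 1 ->
  (j%:R / (k + k)%:R) ^+ m <= survival p g m c.
Proof.
move=> jk; elim: m c => [|m IHm] c cm; first by rewrite expr0.
rewrite survivalS exprSr mulrA [leLHS]mulrC.
apply: ler_wpM2l; first by rewrite invr_ge0.
pose u := (j%:R / (k + k)%:R : R) ^+ m.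
(* Only draws of small items of scale below [j] are kept. *)
apply: le_trans (ler_sum_split (u := fun=> u) (v := fun=> 0) jk _ _).
- by rewrite [X in _ + X]big1// addr0 sumr_const_nat subn0 mulr_natr.
- move=> i ij; apply: ler_wpDr; first exact: s_ge0.
  have ei : N%:R * e i <= e j by apply: le_trans (e_step _) _; apply: e_mono.
  have c' : c + N%:R * e i + m.+1%:R * e j <= 1.
    by move: cm; rewrite -[m.+2%:R]natr1; lra.
  rewrite ifT; first exact: IHm.
  by apply: lt_le_trans c'; rewrite ltrDl mulr_gt0// ltr0n.
- by move=> i _; rewrite addr_ge0// s_ge0.
Qed.

(** Here the bin holds only small items of scale below [j]. All [m] new items being small
    contributes [2^-m]. One large item, of scale at least [j] and above all the small ones,
    contributes about [2^-m (1 - (j/k)^m)], from the integral of [m y^(m-1)] over [[j/k, 1]]; the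
    term [m/k] pays for discreteness. *)
Lemma survival_small j m c : (j <= k)%N -> (m <= N)%N ->
  c + m%:R * e j <= N%:R * e j ->
  2^-1 ^+ m * (2 - (j%:R / k%:R) ^+ m - m%:R / k%:R) <= survival p g m c.
Proof.
elim: m j c => [|m IHm] j c jk mN cm.
  by rewrite !expr0 mul1r mulr0n mul0r subr0 /= addrK.
rewrite survivalS.
pose y i : R := i%:R / k%:R.
pose r i : R := 2^-1 ^+ m * (2 - y i ^+ m - m%:R / k%:R).
pose s : R := 2^-1 ^+ m * (2 - m%:R / k%:R).
have mR : m.+1%:R <= N%:R :> R by rewrite ler_nat.
rewrite -natr1 in cm mR.
(* Below [j] only the small item counts and the scale stays [j]. From [j] on, a small item raises
   the scale to [i.+1], and a large one leaves [m] small items of scale below [i]. The sum of these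
   two bounds is written as a telescoping difference. *)
apply: le_trans (ler_wpM2l _ (ler_sum_split (u := fun=> r j)
  (v := fun i => s - 2^-1 ^+ m * (y i.+1 ^+ m - y i ^+ m)) jk _ _)).
- rewrite sumr_const_nat subn0 sumrB sumr_const_nat -mulr_sumr.
  have -> : \sum_(j <= i < k) (y i.+1 ^+ m - y i ^+ m) = y k ^+ m - y j ^+ m.
    exact: (telescope_sumr (fun i => y i ^+ m) jk).
  rewrite -[r j *+ _]mulr_natl -[s *+ _]mulr_natl natrB//.
  have -> : y k = 1 by rewrite /y divff// gt_eqF.
  rewrite expr1n exprS exprS -natr1 natrD /r /s -/(y j).
  have -> : (k%:R + k%:R)^-1 = 2^-1 * k%:R^-1 :> R.
    by rewrite -mulr2n -[_ *+ 2]mulr_natl invfM.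
  have jy : j%:R = y j * k%:R by rewrite /y mulfVK// gt_eqF.
  have kV : k%:R * k%:R^-1 = 1 :> R by rewrite divff// gt_eqF.
  rewrite jy.
  have y0 : 0 <= y j ^+ m by rewrite exprn_ge0// divr_ge0.
  have h0 : 0 <= (2^-1 : R) ^+ m by rewrite exprn_ge0// invr_ge0.
  have kV0 : 0 <= k%:R^-1 :> R by rewrite invr_ge0.
  rewrite -subr_ge0.
  rewrite (_ : _ - _ = 2^-1 * 2^-1 ^+ m * (k%:R^-1 * y j ^+ m)) ?mulr_ge0 ?invr_ge0//.
  by field; rewrite gt_eqF.
- by rewrite invr_ge0.
- move=> i ij; apply: ler_wpDr; first exact: s_ge0.
  have ei : N%:R * e i <= e j by apply: le_trans (e_step _) _; apply: e_mono.
  have c' : c + N%:R * e i + m%:R * e j <= N%:R * e j by lra.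
  rewrite ifT; first by apply: IHm => //; exact: ltnW.
  apply: le_lt_trans e_top; apply: le_trans (_ : N%:R * e j <= _).
    by apply: le_trans c'; rewrite lerDl mulr_ge0// ltW.
  by rewrite ler_wpM2l// e_mono.
- move=> i ji.
  have -> : s - 2^-1 ^+ m * (y i.+1 ^+ m - y i ^+ m) =
      r i.+1 + (i%:R / (k + k)%:R) ^+ m.
    have -> : i%:R / (k + k)%:R = 2^-1 * y i.
      by rewrite natrD -mulr2n -[_ *+ 2]mulr_natl invfM /y mulrCA.
    by rewrite [(_ * y i) ^+ m]exprMn /r /s; ring.
  have eji : e j <= e i by exact: e_mono.
  have ejS : e j <= e i.+1 by apply: e_mono; exact: leqW.
  (* The hypothesis on [c] reads [c <= (N - m - 1) e j], and this bound may be raised to scale [i]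
     or [i.+1]. *)
  have ej := e_gt0 j; have ei := e_gt0 i; have es := e_step i.
  have Nm : 0 <= N%:R - m%:R - 1 :> R by lra.
  have Ni : (N%:R - m%:R - 1) * e j <= (N%:R - m%:R - 1) * e i by exact: ler_wpM2l.
  have NS : (N%:R - m%:R - 1) * e j <= (N%:R - m%:R - 1) * e i.+1.
    exact: ler_wpM2l.
  have me : 0 <= m%:R * e i.+1 by rewrite mulr_ge0// ltW.
  have me' : 0 <= m%:R * e i by rewrite mulr_ge0// ltW.
  apply: lerD.
    have c' : c + N%:R * e i + m%:R * e i.+1 <= N%:R * e i.+1 by lra.
    rewrite ifT; first by apply: IHm => //; exact: ltnW.
    apply: le_lt_trans e_top; apply: le_trans (_ : N%:R * e i.+1 <= _).
      by lra.
    by rewrite ler_wpM2l// e_mono.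
  rewrite ifT; last by lra.
  by apply: survival_large; [exact: ltnW|rewrite -natr1; lra].
Qed.

(** At [j = 0] and [c = 0], the term [m = 0] gives 1 because [0 ^+ 0 = 1], and [m > 0] gives
    [2 * 2^-m]. Each error [2^-m * m / k] is at most [1 / k]. *)
Lemma mean_survival_ge M : (M < N)%N ->
  3 - 2 * 2^-1 ^+ M - M%:R / k%:R <= mean_survival p g M.+1 0.
Proof.
have base m : (m <= N)%N ->
    2^-1 ^+ m * (2 - 0 ^+ m - m%:R / k%:R) <= survival p g m 0.
  move=> mN; have := @survival_small 0%N m 0 (leq0n _) mN.
  by rewrite mul0r add0r; apply; rewrite ler_wpM2r ?ler_nat// ltW.
have recr r : mean_survival p g r.+1 0 = mean_survival p g r 0 + survival p g r 0.
  by rewrite /mean_survival big_ord_recr.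
elim: M => [|M IHM] MN; rewrite recr.
  rewrite /mean_survival big_ord0 expr0 mulr0n mul0r subr0 add0r mulr1 /=.
  by rewrite lerBlDr.
have := IHM (ltnW MN); have := base M.+1 (ltnW MN).
rewrite expr0n -[M.+1 == 0%N]/false mulr0n subr0 => b1 b2.
have : 2^-1 ^+ M.+1 * (M.+1%:R / k%:R) <= k%:R^-1 :> R.
  rewrite mulrA ler_piMl ?invr_ge0// exprVn ler_pdivrMl ?exprn_gt0// mulr1.
  by rewrite -natrX ler_nat ltnW// ltn_expl.
by move: b1 b2; rewrite -[M.+1%:R]natr1 exprS => b1 b2 b3; lra.
Qed.

End Scales.

(** * Matching complements: a lower bound on OPT *)

Section Matching.
Hypothesis g_pair : forall i, 1 <= g (lshift k i) + g (rshift k i).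

(** Summed over a list, this is the surplus of small over large items of scale [i]. *)
Let sg (i : 'I_k) (x : 'I_(k + k)) : R := (x == lshift k i)%:R - (x == rshift k i)%:R.

Lemma sum_kinds (t : seq 'I_(k + k)) :
  (\sum_(i < k) (count_mem (lshift k i) t + count_mem (rshift k i) t) = size t)%N.
Proof.
elim: t => [|x t IHt] /=; first by rewrite big1.
under eq_bigr do rewrite addnACA.
rewrite big_split /= IHt -[RHS]add1n; congr addn; rewrite big_split /=.
case: (split_ordP x) => j ->.
  rewrite [X in (_ + X)%N]big1 => [|i _]; last by rewrite eq_lrshift.
  rewrite addn0 (bigD1 j)//= eqxx big1// => i ij.
  by rewrite eq_lshift eq_sym (negbTE ij).
rewrite big1 => [|i _]; last by rewrite eq_rlshift.
rewrite add0n (bigD1 j)//= eqxx big1// => i ij.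
by rewrite eq_rshift eq_sym (negbTE ij).
Qed.

(** Removing a complementary pair costs two items, yields one bin and keeps every surplus. Once no
    pair is left, the absolute surpluses add up to the number of items. *)
Lemma matching_OPT (t : seq 'I_(k + k)) :
  (size t)%:R <= 2 * (OPT [seq g x | x <- t])%:R
     + \sum_(i < k) `|\sum_(x <- t) sg i x|.
Proof.
suff [q /coverable_OPT qO tq] : exists2 q, coverable [seq g x | x <- t] q &
    (size t)%:R <= 2 * q%:R + \sum_(i < k) `|\sum_(x <- t) sg i x|.
  by apply: le_trans tq _; rewrite lerD2r ler_wpM2l// ler_nat.
have [n] := ubnP (size t); elim: n t => // n IHn t tn.
have [/existsP[i /andP[li ri]]|] :=
  boolP [exists i : 'I_k, (lshift k i \in t) && (rshift k i \in t)].
  have tl := perm_to_rem li; set t1 := rem _ t in tl.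
  have ri1 : rshift k i \in t1.
    by move: ri; rewrite (perm_mem tl) inE eq_rlshift.
  have tr := perm_to_rem ri1; set t2 := rem _ t1 in tr.
  have tt : perm_eq t [:: lshift k i, rshift k i & t2].
    by apply: perm_trans tl _; rewrite perm_cons.
  have st : size t = (size t2).+2 by rewrite (perm_size tt).
  have st2 : (size t2 < n)%N by move: tn; rewrite st ltnS => /ltnW.
  have [q cq tq] := IHn t2 st2.
  exists q.+1.
    apply: coverable_perm (coverable_cons2 (g_pair i) cq).
    by rewrite perm_sym -[X in perm_eq _ X]/(map g [:: _, _ & t2]) perm_map.
  rewrite (eq_bigr (fun i => `|\sum_(x <- t2) sg i x|)) => [|j _].
    by rewrite st -!natr1; lra.
  rewrite (perm_big _ tt) /= !big_cons addrA.
  rewrite (_ : sg j (lshift k i) + sg j (rshift k i) = 0) ?add0r//.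
  rewrite /sg eq_lshift eq_rshift eq_lrshift eq_rlshift.
  by rewrite subr0 sub0r subrr.
rewrite negb_exists => /forallP noi; exists 0%N; first exact: coverable0.
rewrite mulr0 add0r -[in leLHS](sum_kinds t) natr_sum; apply: ler_sum => i _.
rewrite sumrB -!natr_sum -!big_mkcond /= !sum1_count.
have := noi i; rewrite negb_and => /orP[] /count_memPn ->.
  by rewrite sub0r normrN normr_nat add0n.
by rewrite subr0 normr_nat addn0.
Qed.

(** Each surplus [d] has mean 0 and variance [n / k], and [|d| <= d^2 / (2 C) + C / 2]. A constant
    [C] suffices: the loss linear in [n] is small for large [C]. *)
Lemma Eiid_OPT_ge (C : R) n : 0 < C ->
  n%:R <= 2 * Eiid p n (fun t => (OPT [seq g x | x <- t])%:R)
    + n%:R / (2 * C) + k%:R * C / 2.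
Proof.
move=> C0.
have p0 x : 0 <= p x by rewrite invr_ge0.
have pk : (k + k)%:R^-1 = 2^-1 * k%:R^-1 :> R.
  by rewrite natrD -mulr2n -[_ *+ 2]mulr_natl invfM.
have sum_sg i (f : R -> R) : f 0 = 0 ->
    \sum_x p x * f (sg i x) = (k + k)%:R^-1 * (f 1 + f (- 1)).
  move=> f0; rewrite -mulr_sumr big_split_ord /=; congr (_ * (_ + _)).
    rewrite (bigD1 i)//= big1 => [|l li].
      by rewrite /sg eqxx eq_lrshift subr0 addr0.
    by rewrite /sg eq_lshift (negbTE li) eq_lrshift subr0.
  rewrite (bigD1 i)//= big1 => [|l li].
    by rewrite /sg eqxx eq_rlshift sub0r addr0.
  by rewrite /sg eq_rshift (negbTE li) eq_rlshift subr0.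
have s0 i : \sum_x p x * sg i x = 0.
  by rewrite (sum_sg i id)// subrr mulr0.
have s2 i : \sum_x p x * sg i x ^+ 2 = k%:R^-1.
  by rewrite (sum_sg i (fun z => z ^+ 2)) ?expr0n// pk sqrrN expr1n; lra.
rewrite -[n%:R in leLHS](Eiid_cst paired_prob_sum n).
apply: (@le_trans _ _ (Eiid p n (fun t => 2 * (OPT [seq g x | x <- t])%:R +
    \sum_(i < k) ((2 * C)^-1 * (\sum_(x <- t) sg i x) ^+ 2 + C / 2)))).
  apply: le_Eiid => // t tn; rewrite -[in leLHS]tn.
  apply: le_trans (matching_OPT t) _; rewrite lerD2l; apply: ler_sum => i _.
  set d := \sum_(x <- t) _.
  (* AM-GM *)
  rewrite -(ler_pM2l (mulr_gt0 (ltr0n _ 2) C0)) mulrDr mulVKf; last first.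
    by rewrite mulf_neq0// gt_eqF.
  rewrite -(real_normK (num_real d)) -subr_ge0.
  by rewrite (_ : _ - _ = (`|d| - C) ^+ 2) ?sqr_ge0//; field.
rewrite EiidD EiidZ Eiid_sum -addrA lerD2l.
rewrite (eq_bigr (fun=> (2 * C)^-1 * (k%:R^-1 *+ n) + C / 2)) => [|i _]; last first.
  rewrite EiidD (EiidZ _ _ (2 * C)^-1) (Eiid_cst paired_prob_sum).
  by congr (_ * _ + _); exact: (Eiid_sqr_sumn paired_prob_sum).
rewrite sumr_const card_ord -[_ *+ k]mulr_natl -[_ *+ n]mulr_natl le_eqVlt.
by apply/orP; left; apply/eqP; field; rewrite !gt_eqF.
Qed.

End Matching.
End PairedSizes.

(** * Bounds on lower limits *)

Section LiminfBounds.
Variable R : realType.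
Implicit Types (u : (\bar R)^nat) (a : \bar R).

Lemma limn_einf_ge u a N :
  (forall n, (N <= n)%N -> (a <= u n)%E) -> (a <= limn_einf u)%E.
Proof.
move=> au; rewrite limn_einf_lim; apply: lime_ge; first exact: is_cvg_einfs.
exists N => // n /= Nn; apply: le_ereal_inf_tmp => _ [m /= nm <-].
by apply: au; exact: leq_trans nm.
Qed.

Lemma limn_einf_le u a N :
  (forall n, (N <= n)%N -> (u n <= a)%E) -> (limn_einf u <= a)%E.
Proof.
move=> ua; rewrite limn_einf_lim; apply: lime_le; first exact: is_cvg_einfs.
apply: nearW => n; apply: (@le_trans _ _ (u (maxn n N))).
  by apply: ereal_inf_lbound; exists (maxn n N) => //=; exact: leq_maxl.
exact/ua/leq_maxr.
Qed.

Lemma exists_nat_ge (x : R) : exists n : nat, x <= n%:R.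
Proof.
exists (Num.bound `|x|); apply: le_trans (ler_norm _) _.
by rewrite ltW// archi_boundP.
Qed.

End LiminfBounds.

(** * From the random-order ratio to i.i.d. lists *)

Section RandomOrder.
Variables (R : realType) (F : discrete_distribution).
Let p (i : 'I_(dd_num F)) : R := ratr (dd_prob i).
Let g (i : 'I_(dd_num F)) : R := ratr (dd_size i).

Let p_ge0 i : 0 <= p i. Proof. by rewrite ler0q ltW// dd_prob_gt0. Qed.

Let p_sum : \sum_i p i = 1.
Proof. by rewrite -(rmorph1 (@ratr R)) -(dd_prob_sum F) rmorph_sum. Qed.

Let g_itv i : 0 <= g i <= 1.
Proof.
have /andP[g0 g1] := dd_size_itv i.
by rewrite ler0q g0 -(rmorph1 (@ratr R)) ler_rat.
Qed.

Lemma expect_iidE (A : seq R -> nat) n :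
  expect_iid A F n = Eiid p n (fun t => (A [seq g x | x <- t])%:R).
Proof. by []. Qed.

Lemma expect_perm_ge0 (A : seq R -> nat) L : 0 <= expect_perm A L.
Proof. by rewrite divr_ge0// sumr_ge0. Qed.

(** On lists with [OPT L < k] the bound [r * (OPT L - k)] is at most 0, so it holds for every list
    and can be averaged. *)
Lemma expect_iid_ge (A : seq R -> nat) (r : R) (k n : nat) : 0 <= r ->
  (forall L, item_list L -> (k <= OPT L)%N -> r * (OPT L)%:R <= expect_perm A L) ->
  r * expect_iid (@OPT R) F n - r * k%:R <= expect_iid A F n.
Proof.
move=> r0 rA; rewrite !expect_iidE (Eiid_expect_perm p A) -EiidZ.
rewrite -[X in _ - X](Eiid_cst p_sum n) lerBlDr -EiidD.
apply: le_Eiid => // t _.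
have [kO|Ok] := leqP k (OPT [seq g x | x <- t]).
  by apply: ler_wpDr; [exact: mulr_ge0|apply: rA => //; exact: item_list_map].
by apply: ler_wpDl; [exact: expect_perm_ge0|rewrite ler_wpM2l// ler_nat ltnW].
Qed.

Lemma expect_iid_OPT_ge n : n%:R * (\sum_i p i * g i) <=
  2 * expect_iid (@OPT R) F n + 1.
Proof.
rewrite mulr_natl -(Eiid_sumn p_sum n (erefl _)) expect_iidE -EiidZ.
rewrite -[X in _ + X](Eiid_cst p_sum n) -EiidD; apply: le_Eiid => // t _.
have := @sum_le_DNF_from R [seq g x | x <- t] 0 (item_list_map g_itv t) ltr01.
rewrite add0r big_map => /le_trans; apply.
by rewrite mulrC lerD2r ler_wpM2l// ler_nat DNF_le_OPT.
Qed.

Hypothesis F_pos : has_positive_size F.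

Lemma expect_iid_OPT_unbounded (x : R) :
  exists N : nat, forall n, (N <= n)%N -> x <= expect_iid (@OPT R) F n.
Proof.
have mu0 : 0 < \sum_i p i * g i.
  have [i gi] := F_pos; rewrite (bigD1 i)//= ltr_wpDr//.
    by apply: sumr_ge0 => j _; rewrite mulr_ge0//; case/andP: (g_itv j).
  by rewrite mulr_gt0// ltr0q ?dd_prob_gt0.
have [N xN] := exists_nat_ge ((2 * x + 1) / \sum_i p i * g i).
exists N => n Nn; have := expect_iid_OPT_ge n.
have : N%:R <= n%:R :> R by rewrite ler_nat.
move=> /(le_trans xN); rewrite ler_pdivrMr//; lra.
Qed.

Lemma ROR_term_le_AECR (A : seq R -> nat) (k : nat) :
  (ereal_inf [set (expect_perm A L / (OPT L)%:R)%:E |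
      L in [set L | item_list L /\ (k <= OPT L)%N]] <= AECR A F)%E.
Proof.
set rk := ereal_inf _.
have rk0 : (0 <= rk)%E.
  apply: le_ereal_inf_tmp => _ [L _ <-].
  by rewrite lee_fin divr_ge0 ?expect_perm_ge0.
(* Passing through real [r] below [rk] also covers an infinite [rk]. *)
have key (r : R) : 0 <= r -> (r%:E <= rk)%E -> (r%:E <= AECR A F)%E.
  move=> r0 rrk; apply/lee_subgt0Pr => h h0; rewrite -EFinB.
  (* This makes the loss [r * k] at most [h] times the expected optimum, which is also positive. *)
  have [N ON] := expect_iid_OPT_unbounded (r * k%:R / h + 1).
  apply: (@limn_einf_ge _ _ _ N) => n /ON On; rewrite lee_fin.
  have rkh : 0 <= r * k%:R / h by rewrite !mulr_ge0// invr_ge0 ltW.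
  have O0 : 0 < expect_iid (@OPT R) F n by apply: lt_le_trans On; lra.
  rewrite ler_pdivlMr// mulrBl.
  apply: le_trans (@expect_iid_ge A r k n r0 _).
    rewrite lerD2l lerN2 [leRHS]mulrC -ler_pdivrMr//; lra.
  move=> L L1 kO; have [->|L0] := posnP (OPT L).
    by rewrite mulr0 expect_perm_ge0.
  rewrite -ler_pdivlMr ?ltr0n// -lee_fin; apply: le_trans rrk _.
  by apply: ereal_inf_lbound; exists L.
move: rk0 key; case: rk => [r| |]//.
  by rewrite lee_fin => r0; apply.
move=> _ key; rewrite (@eq_infty _ (AECR A F))// => r.
by apply: le_trans (key `|r| _ _); rewrite ?leey// lee_fin ler_norm.
Qed.

End RandomOrder.

Lemma ROR_le_AECR_inf (R : realType) (A : seq R -> nat) :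
  (ROR A <= AECR_inf A)%E.
Proof.
apply: le_ereal_inf_tmp => _ [F Fpos <-]; apply: lime_le.
  (* The infima run over shrinking sets of lists, so the limit defining [ROR] exists. *)
  apply: ereal_nondecreasing_is_cvgn => m n mn.
  apply: ereal_inf_le_tmp => _ [L [L1 nL] <-]; exists L => //; split => //.
  exact: leq_trans nL.
by apply: nearW => k; exact: ROR_term_le_AECR.
Qed.

(** * The rational distribution with paired sizes *)

Section PairedDistribution.
Variables (N k : nat).

(** The ratio [N.+1] instead of [N] makes the top inequality [N * scale k < 1] strict. The field is
    a parameter because the distribution is rational and the estimates are real. *)
Definition scale (K : numFieldType) (j : nat) : K :=
  N.+1%:R ^+ j / N.+1%:R ^+ k.+1.

Definition paired_size (K : numFieldType) (x : 'I_(k + k)) : K :=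
  match fintype.split x with
  | inl i => N%:R * scale K i
  | inr i => 1 - N%:R * scale K i
  end.

Lemma paired_sizel (K : numFieldType) i :
  paired_size K (lshift k i) = N%:R * scale K i.
Proof. by rewrite /paired_size -[lshift k i]/(unsplit (inl i)) unsplitK. Qed.

Lemma paired_sizer (K : numFieldType) i :
  paired_size K (rshift k i) = 1 - N%:R * scale K i.
Proof. by rewrite /paired_size -[rshift k i]/(unsplit (inr i)) unsplitK. Qed.

Lemma scale_gt0 (K : numFieldType) j : 0 < scale K j.
Proof. by rewrite divr_gt0// exprn_gt0// ltr0n. Qed.

Lemma scale_step (K : numFieldType) j : N%:R * scale K j <= scale K j.+1.
Proof.
by rewrite /scale [_ ^+ j.+1]exprS -mulrA ler_wpM2r// ler_nat.
Qed.

Lemma scale_top (K : numFieldType) : N%:R * scale K k < 1.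
Proof.
rewrite /scale mulrA ltr_pdivrMr ?exprn_gt0 ?ltr0n// mul1r exprS.
by rewrite ltr_pM2r ?exprn_gt0 ?ltr0n// ltr_nat.
Qed.

Lemma scale_itv (K : numFieldType) (i : 'I_k) : 0 <= N%:R * scale K i <= 1.
Proof.
apply/andP; split; first by rewrite mulr_ge0// ltW// scale_gt0.
apply: le_trans (scale_step _ _) _.
rewrite ler_pdivrMr ?exprn_gt0 ?ltr0n// mul1r.
by rewrite ler_weXn2l ?ler1n// ltnS ltnW.
Qed.

Lemma paired_size_itv (K : numFieldType) x : 0 <= paired_size K x <= 1.
Proof.
rewrite /paired_size; case: (fintype.split x) => i; first exact: scale_itv.
by rewrite subr_ge0 lerBlDr lerDl andbC; exact: scale_itv.
Qed.

Lemma ratr_paired_size (R : realType) x :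
  ratr (paired_size rat x) = paired_size R x.
Proof.
have ratr_scale j : ratr (scale rat j) = scale R j.
  by rewrite /scale rmorphM fmorphV !rmorphXn /= ratr_nat.
rewrite /paired_size; case: (fintype.split x) => i.
  by rewrite rmorphM /= ratr_nat ratr_scale.
by rewrite rmorphB rmorph1 rmorphM /= ratr_nat ratr_scale.
Qed.

Hypothesis k_gt0 : (0 < k)%N.

Let kk_gt0 : 0 < (k + k)%:R^-1 :> rat.
Proof. by rewrite invr_gt0 ltr0n addn_gt0 k_gt0. Qed.

Let prob_sum : \sum_(x < k + k) (k + k)%:R^-1 = 1 :> rat.
Proof.
rewrite sumr_const card_ord -[LHS]mulr_natr mulVf//.
by rewrite pnatr_eq0 -lt0n addn_gt0 k_gt0.
Qed.

Definition paired_distribution : discrete_distribution :=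
  DiscreteDistribution (paired_size_itv rat) (fun=> kk_gt0) prob_sum.

Lemma paired_expect_iidE (R : realType) (A : seq R -> nat) n :
  expect_iid A paired_distribution n =
  Eiid (fun=> (k + k)%:R^-1) n (fun t => (A [seq paired_size R x | x <- t])%:R).
Proof.
apply: eq_bigr => t _; congr (_ * _).
  by apply: eq_bigr => i _; rewrite fmorphV /= ratr_nat.
by congr (A _)%:R; apply: eq_map => x /=; rewrite ratr_paired_size.
Qed.

Lemma paired_positive : (0 < N)%N -> has_positive_size paired_distribution.
Proof.
move=> N0; exists (lshift k (Ordinal k_gt0)).
by rewrite /= paired_sizel mulr_gt0 ?ltr0n ?scale_gt0.
Qed.

End PairedDistribution.

(** * Choice of parameters and conclusion *)

Lemma paired_AECR_le (R : realType) (h : R) : 0 < h -> h <= 1 ->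
  exists2 F : discrete_distribution, has_positive_size F &
    (AECR (@DNF R) F <= (2 / 3 + h)%:E)%E.
Proof.
move=> h0 h1.
have [M hM] := exists_nat_ge (4 / h).
have {hM} hM : 4 / h <= M.+1%:R by apply: le_trans hM _; rewrite ler_nat.
have M0 : 0 < M.+1%:R :> R by rewrite ltr0n.
pose q : R := M.+1%:R^-1.
have q0 : 0 < q by rewrite invr_gt0.
have q1 : q <= h / 4.
  by rewrite -[h / 4]invrK lef_pV2 ?posrE ?invr_gt0 ?divr_gt0// invf_div.
(* The square makes the error [M / k] at most [q]. *)
pose k := (M.+1 ^ 2)%N.
have k0 : (0 < k)%N by rewrite expn_gt0.
exists (paired_distribution M.+1 k0); first exact: paired_positive.
pose g := paired_size M.+1 (k := k) R.
pose p (_ : 'I_(k + k)) : R := (k + k)%:R^-1.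
have p_ge0 x : 0 <= p x by rewrite invr_ge0.
have p_sum : \sum_x p x = 1 := paired_prob_sum R k0.
pose W := mean_survival p g M.+1 0.
have W3 : 3 - 3 * q <= W.
  have := @mean_survival_ge R k g k0 M.+1 (scale M.+1 k R) isT
    (scale_gt0 _ _ _) (scale_step _ _ _) (scale_top _ _ _)
    (paired_sizel _ _) (paired_sizer _ _) M (ltnSn M).
  rewrite -/p -/W.
  have : 2^-1 ^+ M <= q.
    rewrite exprVn lef_pV2 ?posrE ?exprn_gt0// -natrX ler_nat.
    exact: ltn_expl.
  have : M%:R / k%:R <= q.
    rewrite /k natrX expr2 invfM mulrA ler_piMl// ?(ltW q0)//.
    by rewrite ler_pdivrMr// mul1r ler_nat.
  lra.
have W0 : 0 < W by lra.
pose a := W^-1.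
have a0 : 0 < a by rewrite invr_gt0.
have aW : a * W = 1 by rewrite mulVf// gt_eqF.
pose rho : R := 2 / 3 + h.
(* This compares the slopes in [n] of [rho] times the bound on OPT, taken with [C = M.+1], and of
   the bound on DNF. *)
pose gap := rho * (2^-1 - q / 4) - a.
have gap0 : 0 < gap.
  rewrite subr_gt0 -(ltr_pM2r W0) aW.
  have : rho * (2^-1 - q / 4) * (3 - 3 * q) <= rho * (2^-1 - q / 4) * W.
    rewrite ler_wpM2l// mulr_ge0//; [rewrite /rho; lra|lra].
  apply: lt_le_trans; rewrite /rho.
  nra.
pose D n := expect_iid (@DNF R) (paired_distribution M.+1 k0) n.
pose O n := expect_iid (@OPT R) (paired_distribution M.+1 k0) n.
have Dn n : D n <= a * n%:R + a * M.+1%:R.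
  have := @Eiid_DNF_from_le R _ p g p_ge0 p_sum (@paired_size_itv M.+1 k R) a M.+1 n
    (ltW a0) _ M.+1 0 (leqnn _).
  rewrite -/W aW lexx /D paired_expect_iidE => /(_ isT); rewrite -/p /DNF -/g; lra.
have On n : n%:R * (2^-1 - q / 4) - k%:R * M.+1%:R / 4 <= O n.
  have := @Eiid_OPT_ge R k g k0 _ M.+1%:R n M0.
  rewrite /O paired_expect_iidE -/p -/g invfM -/q => H.
  have gp i : 1 <= g (lshift k i) + g (rshift k i).
    by rewrite /g paired_sizel paired_sizer; lra.
  have := H gp; lra.
have rho0 : 0 < rho by rewrite /rho; lra.
have slope0 : 0 < 2^-1 - q / 4 by lra.
(* From [N1] on the expected optimum is positive; from [N2] on the gap in slopes outweighs the
   additive constants. *)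
have [N1 HN1] := exists_nat_ge ((k%:R * M.+1%:R / 4 + 1) / (2^-1 - q / 4)).
have [N2 HN2] :=
  exists_nat_ge ((a * M.+1%:R + rho * (k%:R * M.+1%:R / 4)) / gap).
apply: (@limn_einf_le _ _ _ (maxn N1 N2)) => n; rewrite geq_max => /andP[n1 n2].
rewrite lee_fin -/(D n) -/(O n) -/rho.
have {n1}n1 : N1%:R <= n%:R :> R by rewrite ler_nat.
have {n2}n2 : N2%:R <= n%:R :> R by rewrite ler_nat.
have H1 := le_trans HN1 n1; have H2 := le_trans HN2 n2.
rewrite !ler_pdivrMr// in H1 H2.
have O0 : 0 < O n by have := On n; lra.
rewrite ler_pdivrMr//; apply: le_trans (Dn n) _.
have := On n; rewrite -(ler_pM2l rho0) => H3; apply: le_trans H3.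
by move: H2; rewrite /gap; lra.
Qed.

Theorem theorem4 (R : realType) :
  (ROR (@DNF R) <= AECR_inf (@DNF R))%E /\
  (AECR_inf (@DNF R) <= (2 / 3 : R)%:E)%E.
Proof.
split; first exact: ROR_le_AECR_inf.
apply/lee_addgt0Pr => h h0; rewrite -EFinD.
have [||F Fpos FA] := @paired_AECR_le R (Num.min h 1).
- by rewrite lt_min h0 ltr01.
- by rewrite ge_min lexx orbT.
apply: le_trans (ereal_inf_lbound _) (le_trans FA _); first by exists F.
by rewrite lee_fin lerD2l ge_min lexx.
Qed.
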